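(* Let $G$ be a countable group acting on compact metrizable spaces $X,Y_1,Y_2,Z$, and let $\phi_i\colon X\to Y_i$ and $\psi_i\colon Y_i\to Z$ ($i=1,2$) be factor maps that satisfy $\psi_1\circ\phi_1=\psi_2\circ\phi_2$. If $\phi_1,\phi_2$ are proximal and $\psi_1,\psi_2$ are distal, then there exists a conjugacy $\iota\colon Y_1\to Y_2$ such that $\phi_2=\iota\circ\phi_1$ and $\psi_1=\psi_2\circ\iota$.
   Context: All actions are by homeomorphisms, written $(g,x)\mapsto g.x$. A factor map $\pi\colon X\to Y$ between actions of $G$ is a continuous surjection with $\pi(g.x)=g.\pi(x)$ for all $g\in G$, $x\in X$; a conjugacy is an injective factor map (hence a homeomorphism). Put $R(\pi):=\{(x,x')\in X^2;\ \pi(x)=\pi(x')\}$. With $d$ a metric inducing the topology of $X$ (the choice is irrelevant), a pair $(x,x')\in X^2$ is proximal if $\inf_{g\in G}d(g.x,g.x')=0$. The factor map $\pi$ is proximal if every pair in $R(\pi)$ is proximal, and distal if the only proximal pairs in $R(\pi)$ are those with $x=x'$. *)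

(* Defs.v *)
From HB Require Import structures.
From mathcomp Require Export all_boot all_order all_algebra.
From mathcomp Require Export all_classical reals topology.

Set Implicit Arguments.
Unset Strict Implicit.
Unset Printing Implicit Defensive.

Local Open Scope classical_set_scope.
Local Open Scope ring_scope.

(* Each [act g] is a homeomorphism: [act_continuous] applies to [g] and to
   [g^-1], whose actions are mutually inverse by [act1] and [actM]. *)
Record group_action (G : groupType) (X : topologicalType) := GroupAction {
  act :> G -> X -> X;
  act1 : forall x, act 1%g x = x;
  actM : forall g h x, act (g * h)%g x = act g (act h x);
  act_continuous : forall g, continuous (act g)
}.

Section Topological.
Variables (G : groupType) (X Y : topologicalType).
Variables (aX : group_action G X) (aY : group_action G Y) (pi : X -> Y).

Definition factor_map : Prop :=
  [/\ continuous pi, set_surj [set: X] [set: Y] pi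
    & forall g x, pi (aX g x) = aY g (pi x)].

Definition conjugacy : Prop := factor_map /\ injective pi.

End Topological.

Definition fiber_pairs (X Y : Type) (pi : X -> Y) : set (X * X) :=
  [set p | pi p.1 = pi p.2].

Section Metric.
Variables (R : realType) (G : groupType) (X : metricType R).
Variable aX : group_action G X.

(* The set of distances is nonempty and bounded below by 0, so [inf] is its
   genuine greatest lower bound. *)
Definition proximal_pair (p : X * X) : Prop :=
  inf [set mdist (aX g p.1) (aX g p.2) | g in [set: G]] = 0.

Definition proximal_map (Y : Type) (pi : X -> Y) : Prop :=
  forall p, fiber_pairs pi p -> proximal_pair p.

Definition distal_map (Y : Type) (pi : X -> Y) : Prop :=
  forall p, fiber_pairs pi p -> proximal_pair p -> p.1 = p.2.

End Metric.

(* Main.v *)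
Require Import Defs.
From mathcomp Require Import all_boot all_order all_algebra.
From mathcomp Require Import all_classical reals topology.

(** Two points of [X] with the same image in [Y1] form a proximal pair, because
    [phi1] is proximal.  Factor maps out of a compact space are uniformly
    continuous, hence carry proximal pairs to proximal pairs; so the images of
    the two points in [Y2] are proximal.  They also lie over the same point of
    [Z], because [psi2 \o phi2 = psi1 \o phi1], and [psi2] is distal, so they
    coincide ([proximal_distal_collapse]).  By symmetry [phi1] and [phi2] have
    exactly the same fibres.

    Therefore [phi2] factors through [phi1] by an injective map [iota], which is
    surjective and equivariant because [phi1] and [phi2] are.  It is continuous
    because a continuous surjection from a compact space onto a Hausdorff space
    is a quotient map ([compact_quotient_continuous]). *)

Set Implicit Arguments.

Import Order.TTheory GRing.Theory Num.Theory.

Local Open Scope classical_set_scope.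
Local Open Scope ring_scope.

(** The Heine-Cantor theorem.  The scale supplied by continuity of [f] at [x]
    is halved, so that it controls [f] on pairs near [x] whose first point need
    not be [x]; compactness then makes finitely many scales suffice. *)
Lemma compact_unif_continuous (U V : uniformType) (f : U -> V) :
  compact [set: U] -> continuous f -> unif_continuous f.
Proof.
move=> /compact_near_coveringP cptU ctsf A entA.
(* Near [F] means for all sufficiently small sets of pairs. *)
pose F := filter_from (@entourage U) (fun D => [set E | E `<=` D]).
have filterF : Filter F.
  apply: filter_from_filter => [|D E entD entE].
    by exists setT; exact: entourageT.
  exists (D `&` E) => [|C /=]; first exact: filterI.
  by rewrite subsetI.
have [E entE EA] : \forall E \near F,
    [set: U] `<=` [set x | forall y, E (x, y) -> A (f x, f y)].
  apply: (cptU _ _ (fun E x => forall y, E (x, y) -> A (f x, f y))) => x _.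
  (* Symmetrized, so that both points of a pair can be compared with [f x]. *)
  have entB := entourage_invI (entourage_split_ent entA).
  have : nbhs x
      [set z | (split_ent A `&` (split_ent A)^-1%relation) (f x, f z)].
    exact: cvg_entourage (ctsf x) _ entB.
  move=> /nbhsP[W entW WB].
  exists (xsection (split_ent W) x, [set E | E `<=` split_ent W]).
    split=> /=; first exact/nbhs_entourage/entourage_split_ent.
    by exists (split_ent W) => //; exact: entourage_split_ent.
  move=> [x' E] /= [/xsectionP xx' sEW] y /sEW x'y.
  have Wx' : W (x, x') by exact: split_ent_subset.
  have Wy : W (x, y) by exact: entourage_split xx' x'y.
  have [_ fx'x] := WB x' ((xsectionP _ _ _).2 Wx').
  have [fxy _] := WB y ((xsectionP _ _ _).2 Wy).
  exact: entourage_split fx'x fxy.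
by apply: filterS entE => -[x y] /= Exy; exact: (EA E).
Qed.

(** The infimum is only approached, so this is the form in which proximality
    passes through a uniformly continuous map. *)
Lemma proximal_pairP (R : realType) (G : groupType) (X : metricType R)
    (aX : group_action G X) (p : X * X) :
  proximal_pair aX p <->
  forall e : R, 0 < e -> exists g, mdist (aX g p.1) (aX g p.2) < e.
Proof.
rewrite /proximal_pair; set D := (X in inf X).
have D0 : D !=set0 by exists (mdist (aX 1%g p.1) (aX 1%g p.2)), 1%g.
have lbD : lbound D 0 by move=> _ [g _ <-]; exact: mdist_ge0.
split=> [infD0 e e0|small].
  have [|_ [g _ <-] ge] := @inf_lt _ D e D0; first by rewrite infD0.
  by exists g.
apply/eqP; rewrite eq_le lb_le_inf// andbT.
apply/ler_addgt0Pl => e e0; rewrite addr0.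
have [g ge] := small e e0.
apply: le_trans (ltW ge); apply: ge_inf; first by exists 0.
by exists g.
Qed.

Lemma proximal_pair_factor (R : realType) (G : groupType) (X Y : metricType R)
    (aX : group_action G X) (aY : group_action G Y) (phi : X -> Y) :
  compact [set: X] -> factor_map aX aY phi ->
  forall x x', proximal_pair aX (x, x') -> proximal_pair aY (phi x, phi x').
Proof.
move=> cptX [ctsphi _ equi] x x' /proximal_pairP prox.
apply/proximal_pairP => e e0.
have /unif_continuousP/(_ e e0)[d d0 phid] := compact_unif_continuous cptX ctsphi.
have [g gd] := prox d d0.
exists g; rewrite /= -!equi.
by have := phid (aX g x, aX g x'); rewrite !ballEmdist; apply.
Qed.

(** Push the proximal pair given by [phi1] forward along [phi2]: it stays
    proximal and lies in a single fibre of the distal map [psi2]. *)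
Lemma proximal_distal_collapse (R : realType) (G : groupType)
    (X Y2 : metricType R) (Y1 Z : Type)
    (aX : group_action G X) (aY2 : group_action G Y2)
    (phi1 : X -> Y1) (phi2 : X -> Y2) (psi1 : Y1 -> Z) (psi2 : Y2 -> Z) :
  compact [set: X] -> factor_map aX aY2 phi2 ->
  psi1 \o phi1 = psi2 \o phi2 ->
  proximal_map aX phi1 -> distal_map aY2 psi2 ->
  forall x x', phi1 x = phi1 x' -> phi2 x = phi2 x'.
Proof.
move=> cptX fac2 comm prox1 dist2 x x' eq1.
apply: (dist2 (phi2 x, phi2 x')).
  have commE z := congr1 (@^~ z) comm.
  by move: (commE x) (commE x') => /= ex ex'; rewrite /fiber_pairs/= -ex -ex' eq1.
by apply: proximal_pair_factor fac2 _ _ _ => //; exact: prox1.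
Qed.

(** Preimages of closed sets under [h] are images under [f] of closed, hence
    compact, sets. *)
Lemma compact_quotient_continuous (X Y W : topologicalType)
    (f : X -> Y) (h : Y -> W) :
  compact [set: X] -> hausdorff_space Y -> continuous f ->
  set_surj [set: X] [set: Y] f -> continuous (h \o f) -> continuous h.
Proof.
move=> cptX hausY ctsf surjf /continuous_closedP ctshf.
apply/continuous_closedP => A /ctshf clA.
have -> : h @^-1` A = f @` ((h \o f) @^-1` A).
  apply/seteqP; split=> [y hy|_ [x hx <-]//].
  by have [x _ fxy] := surjf y I; exists x; rewrite //= fxy.
apply: compact_closed => //; apply: continuous_compact.
  exact: continuous_subspaceT.
exact: subclosed_compact cptX _.
Qed.

Lemma surj_factor (X Y W : Type) (f : X -> Y) (k : X -> W) :
  set_surj [set: X] [set: Y] f ->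
  (forall x x', f x = f x' -> k x = k x') ->
  exists h : Y -> W, k = h \o f.
Proof.
move=> surjf fibre.
have /choice[s sK] : forall y, exists x, f x = y.
  by move=> y; have [x _ <-] := surjf y I; exists x.
by exists (k \o s); apply/funext => x /=; apply: fibre; rewrite sK.
Qed.

Theorem theorem10p5 (R : realType) (G : groupType)
    (X Y1 Y2 Z : metricType R)
    (aX : group_action G X) (aY1 : group_action G Y1)
    (aY2 : group_action G Y2) (aZ : group_action G Z)
    (phi1 : X -> Y1) (phi2 : X -> Y2) (psi1 : Y1 -> Z) (psi2 : Y2 -> Z) :
  countable [set: G] ->
  compact [set: X] -> compact [set: Y1] -> compact [set: Y2] ->
  compact [set: Z] ->
  factor_map aX aY1 phi1 -> factor_map aX aY2 phi2 ->
  factor_map aY1 aZ psi1 -> factor_map aY2 aZ psi2 ->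
  psi1 \o phi1 = psi2 \o phi2 ->
  proximal_map aX phi1 -> proximal_map aX phi2 ->
  distal_map aY1 psi1 -> distal_map aY2 psi2 ->
  exists iota : Y1 -> Y2,
    [/\ conjugacy aY1 aY2 iota, phi2 = iota \o phi1 & psi1 = psi2 \o iota].
Proof.
move=> _ cptX _ _ _ fac1 fac2 _ _ comm prox1 prox2 dist1 dist2.
have fibre12 := proximal_distal_collapse cptX fac2 comm prox1 dist2.
have fibre21 := proximal_distal_collapse cptX fac1 (esym comm) prox2 dist1.
case: (fac1) (fac2) => [cts1 surj1 equi1] [cts2 surj2 equi2].
have [iota phi2E] := surj_factor phi2 surj1 fibre12.
have iotaE x : iota (phi1 x) = phi2 x by rewrite phi2E.
have phi1_ind (P : Y1 -> Prop) : (forall x, P (phi1 x)) -> forall y, P y.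
  by move=> Pphi1 y; have [x _ <-] := surj1 y I.
exists iota; split=> //; last first.
  apply/funext; apply: phi1_ind => x /=; rewrite iotaE.
  exact: (congr1 (@^~ x) comm).
split; last first.
  elim/phi1_ind => x; elim/phi1_ind => x'; rewrite !iotaE; exact: fibre21.
split.
- apply: compact_quotient_continuous cptX _ cts1 surj1 _.
    exact: metric_hausdorff.
  by rewrite -phi2E.
- by move=> y /surj2[x _ <-]; exists (phi1 x).
- by move=> g; apply: phi1_ind => x; rewrite -equi1 !iotaE equi2.
Qed.
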